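(* Let $S$ be a finitely generated transcendental semigroup and let $T$ be a subsemigroup of $S$ of finite Rees index in $S$. Then $I(S)=I(T)$, $J(S)=J(T)$ and $F(S)=F(T)$.
   Context: A transcendental semigroup is a semigroup $S=\langle f_\alpha\rangle_{\alpha\in\Delta}$ under composition generated by a family of transcendental entire maps $f_\alpha:\mathbb{C}\to\mathbb{C}$; its elements are all finite compositions $f_{\alpha_1}\circ\cdots\circ f_{\alpha_m}$ ($m\ge1$) of generators. It is finitely generated if it is generated by finitely many such maps. A subsemigroup of $S$ is a non-empty subset $T\subset S$ closed under composition. The Rees index of $T$ in $S$ is $|S\setminus T|+1$. Normality: $S$ is normal on a domain $D$ if every sequence of elements of $S$ has a subsequence which is uniformly convergent or divergent (to $\infty$) on all compact subsets of $D$. The Fatou set is $F(S)=\{z\in\mathbb{C}: S \text{ is normal in a neighborhood of } z\}$, and the Julia set is $J(S)=\mathbb{C}\setminus F(S)$. The escaping set is $I(S)=\{z\in\mathbb{C}: f^n(z)\to\infty \text{ as } n\to\infty \text{ for every } f\in S\}$, where $f^n$ is the $n$-th iterate of $f$. The sets $F(T),J(T),I(T)$ are defined in the same way with $T$ in place of $S$. *)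

(* Defs.v *)
From mathcomp Require Import all_boot all_order all_algebra.
From mathcomp Require Import complex.
From mathcomp Require Import all_classical all_reals all_analysis.

Set Implicit Arguments.
Unset Strict Implicit.
Unset Printing Implicit Defensive.
Import Order.TTheory GRing.Theory Num.Theory.
Import numFieldNormedType.Exports.
Local Open Scope classical_set_scope.
Local Open Scope card_scope.
Local Open Scope ring_scope.

(* The complex plane over R.  The annotation lets the field topology and norm
   that MathComp-Analysis puts on any numClosedFieldType be inferred; its norm
   is C-valued, with values among the nonnegative reals. *)
Definition Cplx (R : realType) : numClosedFieldType := R[i]%C.

Section TranscendentalSemigroups.
Variable R : realType.
Local Notation C := (Cplx R).
Implicit Types (f g : C -> C) (S T G : set (C -> C)) (D : set C).

(* The base field is C, so derivable is complex differentiability. *)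
Definition entire f := forall z : C, derivable f z 1.

Definition transcendental_entire f :=
  entire f /\ ~ exists p : {poly C}, forall z, f z = p.[z].

(* The compositions g_0 \o ... \o g_m, m >= 0, of elements of G; the
   identity is not included as an empty composition. *)
Definition generated_semigroup G : set (C -> C) :=
  [set h | exists m (g : 'I_m.+1 -> C -> C),
    (forall i, G (g i)) /\ h = \big[comp/id]_(i < m.+1) g i].

Definition fg_transcendental_semigroup S :=
  exists G, [/\ finite_set G, G `<=` transcendental_entire
    & S = generated_semigroup G].

Definition subsemigroup T S :=
  [/\ T !=set0, T `<=` S & forall f g, T f -> T g -> T (f \o g)].

(* The Rees index #|S \ T| + 1, when that cardinal is finite. *)
Definition rees_index_is T S (n : nat) :=
  exists2 k, S `\` T #= `I_k & n = k.+1.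

Definition finite_rees_index T S := exists n, rees_index_is T S n.

Definition domain D := [/\ open D, connected D & D !=set0].

Definition cvg_on_compacts D (u : nat -> C -> C) :=
  exists g, {family compactly_in D, u n @[n --> \oo] --> g}.

Definition dvg_on_compacts D (u : nat -> C -> C) :=
  forall K, compactly_in D K -> forall M : C, M \is Num.real ->
    \forall n \near \oo, forall z, K z -> M < `|u n z|.

Definition normal_on S D :=
  forall u : nat -> C -> C, (forall n, S (u n)) ->
  exists2 phi : nat -> nat, {homo phi : m n / (m < n)%N} &
    cvg_on_compacts D (u \o phi) \/ dvg_on_compacts D (u \o phi).

Definition Fatou S : set C :=
  [set z | exists D, [/\ domain D, D z & normal_on S D]].

Definition Julia S : set C := ~` Fatou S.

Definition escaping S : set C :=
  [set z | forall f, S f -> `|iter n f z| @[n --> \oo] --> +oo].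

End TranscendentalSemigroups.

(* Main.v *)
Require Import Defs.
From mathcomp Require Import all_boot all_order all_algebra.
From mathcomp Require Import complex.
From mathcomp Require Import all_classical all_reals all_analysis.
From mathcomp Require Import ring lra.

Set Implicit Arguments.
Unset Strict Implicit.
Unset Printing Implicit Defensive.
Import Order.TTheory GRing.Theory Num.Theory.
Import numFieldNormedType.Exports.
Local Open Scope classical_set_scope.
Local Open Scope ring_scope.

(* Only finitely many elements are lost in T, so any sequence in S has a
   subsequence that lies in T or is constant: normality is the same for both.
   If some iterate of f lies in T, then f escapes at z when this iterate does,
   because f is bounded on bounded sets. Otherwise two iterates of f coincide
   by the pigeonhole principle. The image of a nonconstant entire map is dense,
   so an iterate of f of positive order is the identity, and the innermost
   generator g in f has an entire left inverse. Then g is proper and injective,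
   so that z / (g z - g 0) extends continuously to 0 and is o(z) at infinity; by
   Liouville's theorem it is constant and g is affine, a contradiction.

   Liouville's theorem is obtained for functions F that are continuous on C,
   differentiable off 0 and o(z) at infinity: for w != 0 the function
   k(s + i t) = (F(w + e^(s + i t)) - F w) / e^(s + i t) is 2 i pi-periodic, so by
   Goursat's theorem its mean over t does not depend on s; this mean tends to
   F'(w) when s -> -oo and to 0 when s -> +oo. *)

(** * The complex plane over R *)

Section ComplexModulus.
Variable R : realType.
Local Notation C := (Cplx R).
Implicit Types (z w : C) (r : R).

(* Real-valued: the norm that MathComp-Analysis puts on [C] is [C]-valued. *)
Definition cmod z : R := Normc.normc (z : R[i]).

Lemma normr_cmod z : `|z| = (cmod z)%:C%C :> C. Proof. by []. Qed.

Lemma cmod_ge0 z : 0 <= cmod z.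
Proof. by case: z => a b; exact: sqrtr_ge0. Qed.

Lemma cmod0 : cmod 0 = 0. Proof. exact: Normc.normc0. Qed.

Lemma cmod_eq0 z : (cmod z == 0) = (z == 0).
Proof.
by apply/eqP/eqP => [/Normc.eq0_normc //|->]; exact: cmod0.
Qed.

Lemma cmod_gt0 z : (0 < cmod z) = (z != 0).
Proof. by rewrite lt_def cmod_ge0 andbT cmod_eq0. Qed.

Lemma cmodM z w : cmod (z * w) = cmod z * cmod w.
Proof. exact: Normc.normcM. Qed.

Lemma cmodV z : cmod z^-1 = (cmod z)^-1.
Proof. exact: Normc.normcV. Qed.

Lemma cmodN z : cmod (- z) = cmod z.
Proof. exact: normcN. Qed.

Lemma ler_cmodD z w : cmod (z + w) <= cmod z + cmod w.
Proof. exact: le_normcD. Qed.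

Lemma ler_cmodB z w : cmod (z - w) <= cmod z + cmod w.
Proof. by rewrite -(cmodN w) ler_cmodD. Qed.

Lemma cmodBC z w : cmod (z - w) = cmod (w - z).
Proof. by rewrite -cmodN opprB. Qed.

Lemma cmod_real r : cmod (r%:C%C : C) = `|r|.
Proof. by rewrite /cmod /= expr0n addr0 sqrtr_sqr. Qed.

Lemma ler_Re_cmod z : `|complex.Re z| <= cmod z.
Proof.
case: z => a b; rewrite /cmod/= -sqrtr_sqr.
rewrite ler_sqrt; last first.
  by rewrite addr_ge0 ?sqr_ge0.
by rewrite lerDl sqr_ge0.
Qed.

Lemma ler_Im_cmod z : `|complex.Im z| <= cmod z.
Proof.
case: z => a b; rewrite /cmod/= -sqrtr_sqr.
rewrite ler_sqrt; last first.
  by rewrite addr_ge0 ?sqr_ge0.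
by rewrite lerDr sqr_ge0.
Qed.

Lemma ler_cmod_ReIm z : cmod z <= `|complex.Re z| + `|complex.Im z|.
Proof.
rewrite -[leRHS]ger0_norm ?addr_ge0// -[leRHS]sqrtr_sqr.
case: z => a b; rewrite /cmod/= ler_sqrt ?sqr_ge0//.
rewrite sqrrD !real_normK ?num_real// lerD2r lerDl.
by rewrite mulrn_wge0// mulr_ge0.
Qed.

Lemma cplx_gt0P z : 0 < z -> exists2 r, 0 < r & z = r%:C%C.
Proof.
case: z => [a b]; rewrite ltcE /= => /andP[/eqP bE a0].
by exists a => //; rewrite bE.
Qed.

(** Positive elements of [C] are positive reals, so the [C]-valued radii of balls can be exchanged
    for radii in [R], where all later estimates take place. *)
Lemma nbhs_cplxP z (A : set C) :
  nbhs z A <-> exists2 e : R, 0 < e & forall w, cmod (w - z) < e -> A w.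
Proof.
split => [/nbhs_ballP[e /= e0 eA]|[e e0 eA]].
  have [r r0 re] := cplx_gt0P e0.
  exists r => // w wz; apply: eA; rewrite -ball_normE /ball_ /=.
  by rewrite distrC normr_cmod re ltcR.
apply/nbhs_ballP; exists (e%:C%C : C); first by rewrite /= ltcR.
move=> w; rewrite -ball_normE /ball_ /= distrC normr_cmod ltcR; exact: eA.
Qed.

Lemma continuous_cplxP (f : C -> C) z : {for z, continuous f} <->
  forall e : R, 0 < e -> exists2 d : R, 0 < d &
    forall h, cmod h < d -> cmod (f (z + h) - f z) <= e.
Proof.
split => [fz e e0|H].
  have /fz/nbhs_cplxP[d d0 dP] : nbhs (f z) [set w | cmod (w - f z) <= e].
    by apply/nbhs_cplxP; exists e => // w /ltW.
  by exists d => // h hd; apply: dP; rewrite addrC addKr.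
move=> A /nbhs_cplxP[e e0 eA].
have [d d0 dP] := H _ (divr_gt0 e0 (ltr0Sn R 1)).
apply/nbhs_cplxP; exists d => // w wz; apply: eA.
have /dP := wz; rewrite (addrC z) subrK => /le_lt_trans; apply.
by rewrite ltr_pdivrMr// ltr_pMr// ltr1n.
Qed.

(** Multiplying the difference quotient by [h] removes the exclusion of [h = 0]; the derivative
    appears as an explicit coefficient [d]. *)
Lemma derivable_cplxP (f : C -> C) z : derivable f z 1 <->
  exists d : C, forall e : R, 0 < e -> exists2 r : R, 0 < r &
    forall h, cmod h < r -> cmod (f (z + h) - f z - d * h) <= e * cmod h.
Proof.
split.
  move/cvg_ex => [d /= dP]; exists d => e e0.
  have /dP : nbhs d [set w : C | cmod (w - d) <= e].
    by apply/nbhs_cplxP; exists e => // w /ltW.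
  move=> /nbhs_cplxP[r r0 rP]; exists r => // h hr.
  have [->|h0] := eqVneq h 0; first by
    rewrite addr0 subrr sub0r mulr0 oppr0 cmod0 mulr0.
  have := rP h; rewrite subr0 => /(_ hr h0) /=.
  rewrite [_ *: 1]mulr1 => H.
  have -> : f (z + h) - f z - d * h = (h^-1 * (f (h + z) - f z) - d) * h.
    by rewrite mulrBl mulrAC mulVf// mul1r (addrC z).
  by rewrite cmodM ler_wpM2r// cmod_ge0.
move=> [d dP]; apply/cvg_ex; exists d => A /nbhs_cplxP[e e0 eA].
have [r r0 rP] := dP _ (divr_gt0 e0 (ltr0Sn R 1)).
apply/nbhs_cplxP; exists r => // h; rewrite subr0 => hr h0.
apply: eA => /=; rewrite [_ *: 1]mulr1.
have -> : h^-1 *: (f (h + z) - f z) - d = (f (z + h) - f z - d * h) / h.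
  by rewrite mulrBl mulfK// (addrC z) mulrC.
rewrite cmodM cmodV ltr_pdivrMr ?cmod_gt0//.
apply: le_lt_trans (rP _ hr) _; rewrite ltr_pM2r ?cmod_gt0//.
by rewrite ltr_pdivrMr// ltr_pMr// ltr1n.
Qed.

End ComplexModulus.
Arguments cmod {R} z : simpl never.

(** * Bisection of rectangles *)

Section Bisection.
Variable R : realType.

(** Each left endpoint lies below each right endpoint, so the supremum of the left endpoints is a
    common point. *)
Lemma nested_interval_point (a : nat -> R) (l : R) :
  (forall n, a n <= a n.+1) ->
  (forall n, a n.+1 + l / 2 ^+ n.+1 <= a n + l / 2 ^+ n) -> 0 <= l ->
  exists x, forall n, a n <= x <= a n + l / 2 ^+ n.
Proof.
move=> a_incr b_decr l0.
have la n : 0 <= l / 2 ^+ n by rewrite divr_ge0// exprn_ge0.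
have aD m n : a m <= a (m + n)%N.
  by elim: n => [|n IH]; rewrite ?addn0// addnS (le_trans IH).
have bD m n : a (m + n)%N + l / 2 ^+ (m + n) <= a m + l / 2 ^+ m.
  by elim: n => [|n IH]; rewrite ?addn0// addnS (le_trans _ IH).
have ab m n : a m <= a n + l / 2 ^+ n.
  have [/subnKC <-|/ltnW/subnKC <-] := leqP m n.
    by apply: (le_trans (aD m (n - m)%N)); rewrite lerDl.
  by apply: (le_trans _ (bD n (m - n)%N)); rewrite lerDl.
exists (sup (range a)) => n; apply/andP; split.
  apply: ub_le_sup; last by exists n.
  by exists (a 0%N + l / 2 ^+ 0) => _ [m _ <-].
apply: ge_sup; first by exists (a 0%N); exists 0%N.
by move=> _ [m _ <-].
Qed.

(* The rectangle with corner (a, c), width w and height h is a, c, w, h. *)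
Lemma rectangle_bisection (B : R -> R -> R -> R -> Prop) (a c w h : R) :
  0 < w -> 0 < h ->
  (forall a c w h, 0 < w -> 0 < h -> B a c w h ->
    exists2 p, p \in [:: (a, c); (a + w / 2, c); (a, c + h / 2);
                        (a + w / 2, c + h / 2)] & B p.1 p.2 (w / 2) (h / 2)) ->
  B a c w h ->
  exists x y, forall e, 0 < e -> exists q a' c',
    [/\ 0 < q < e, a <= a' <= x, x <= a' + q * w <= a + w,
        c <= c' <= y & y <= c' + q * h <= c + h] /\ B a' c' (q * w) (q * h).
Proof.
move=> w0 h0 stepB B0; pose q n : R := (2 ^+ n)^-1.
have q0 n : 0 < q n by rewrite invr_gt0 exprn_gt0.
have qS n : q n.+1 = q n / 2 by rewrite /q exprS invfM mulrC.
pose Bn n (p : R * R) := B p.1 p.2 (q n * w) (q n * h).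
pose near_corner n (p p' : R * R) :=
  [/\ p.1 <= p'.1, p'.1 + q n.+1 * w <= p.1 + q n * w,
      p.2 <= p'.2 & p'.2 + q n.+1 * h <= p.2 + q n * h].
(* The step is made total, with no claim where [Bn] fails, so that [choice] gives a function that
   can be iterated from [(a, c)]. *)
have stepP (np : nat * (R * R)) : exists p',
    Bn np.1 np.2 -> Bn np.1.+1 p' /\ near_corner np.1 np.2 p'.
  case: np => n p /=; have [Bp|nBp] := pselect (Bn n p); last by exists p.
  have wn0 : 0 < q n * w by rewrite mulr_gt0.
  have hn0 : 0 < q n * h by rewrite mulr_gt0.
  have [p' p'in Bp'] := stepB _ _ _ _ wn0 hn0 Bp.
  exists p' => _; split.
    by rewrite /Bn qS !(mulrAC _ 2^-1).
  rewrite /near_corner !qS !(mulrAC _ 2^-1).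
  set u := q n * w in wn0 p'in *; set v := q n * h in hn0 p'in *.
  by move: p'in; rewrite !inE => /or4P[] /eqP -> /=; split; lra.
have [f fP] := choice stepP.
pose p := fix p n := if n is m.+1 then f (m, p m) else (a, c).
have Bp n : Bn n (p n).
  elim: n => [|n IH]; first by rewrite /Bn/= /q expr0 invr1 !mul1r.
  by case: (fP (n, p n) IH).
have pP n : near_corner n (p n) (p n.+1) by case: (fP (n, p n) (Bp n)).
have [x xP] : exists x, forall n, (p n).1 <= x <= (p n).1 + w / 2 ^+ n.
  apply: nested_interval_point; last exact: ltW.
    by move=> n; case: (pP n).
  by move=> n; rewrite !(mulrC w); case: (pP n).
have [y yP] : exists y, forall n, (p n).2 <= y <= (p n).2 + h / 2 ^+ n.
  apply: nested_interval_point; last exact: ltW.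
    by move=> n; case: (pP n).
  by move=> n; rewrite !(mulrC h); case: (pP n).
have inside n : [/\ a <= (p n).1, (p n).1 + q n * w <= a + w,
    c <= (p n).2 & (p n).2 + q n * h <= c + h].
  elim: n => [|n [? ? ? ?]]; first by rewrite /= /q expr0 invr1 !mul1r !lexx.
  by case: (pP n) => *; split; apply: le_trans; eassumption.
(* For this [n], [e^-1 < n < 2 ^ n], hence [q n < e]. *)
exists x, y => e e0; pose n := Num.bound e^-1; exists (q n), (p n).1, (p n).2.
have qne : q n < e.
  rewrite /q -[e]invrK ltf_pV2 ?posrE ?invr_gt0 ?exprn_gt0//.
  have := archi_boundP (ltW (_ : 0 < e^-1)); rewrite invr_gt0 => /(_ e0).
  move=> /lt_trans; apply; rewrite -natrX ltr_nat; exact: ltn_expl.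
case: (inside n) => -> -> -> ->.
have /andP[-> ] := xP n; have /andP[-> ] := yP n.
rewrite -/(q n) (mulrC w) (mulrC h) => -> ->; rewrite q0 qne; split=> //.
exact: Bp.
Qed.

(** A form of compactness: if [G] failed, bisection would give failing rectangles shrinking to a
    point, against the local hypothesis there. The small rectangles keep the proportions of the
    whole, as Goursat's estimate requires. *)
Lemma rectangle_induction (G : R -> R -> R -> R -> Prop) (a c w h : R) :
  0 < w -> 0 < h ->
  (forall a c w h, 0 < w -> 0 < h ->
    G a c (w / 2) (h / 2) -> G (a + w / 2) c (w / 2) (h / 2) ->
    G a (c + h / 2) (w / 2) (h / 2) ->
    G (a + w / 2) (c + h / 2) (w / 2) (h / 2) -> G a c w h) ->
  (forall x y, a <= x <= a + w -> c <= y <= c + h ->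
    exists2 e, 0 < e & forall q a' c', 0 < q < e ->
      a <= a' <= x -> x <= a' + q * w <= a + w ->
      c <= c' <= y -> y <= c' + q * h <= c + h -> G a' c' (q * w) (q * h)) ->
  G a c w h.
Proof.
move=> w0 h0 glue loc; apply: contrapT => nG.
have [|x [y xyP]] := @rectangle_bisection
    (fun a c w h => ~ G a c w h) a c w h w0 h0 _ nG.
  move=> {nG loc} a' c' w' h' w'0 h'0 nG; apply: contrapT => nex.
  apply: nG; apply: glue => //; apply: contrapT => nG; apply: nex.
  - by exists (a', c'); rewrite // inE eqxx.
  - by exists (a' + w' / 2, c'); rewrite // !inE eqxx orbT.
  - by exists (a', c' + h' / 2); rewrite // !inE eqxx !orbT.
  - by exists (a' + w' / 2, c' + h' / 2); rewrite // !inE eqxx !orbT.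
(* This use with bound 1 only places the limit point in the rectangle. *)
have [q0 [a0 [c0 [[_ /andP[aa0 a0x] /andP[xa0 a0a]]]]]] := xyP _ ltr01.
move=> /andP[cc0 c0y] /andP[yc0 c0c] _.
have [||e e0 eP] := loc x y; first by rewrite (le_trans aa0)// (le_trans xa0).
  by rewrite (le_trans cc0)// (le_trans yc0).
have [q [a' [c' [[qe a'x xa' c'y yc']]]]] := xyP _ e0.
by apply; exact: eP.
Qed.

End Bisection.

(** * Continuous functions on compact rectangles *)

Section CompactRectangles.
Variable R : realType.
Local Notation C := (Cplx R).
Implicit Types (f : C -> C).

(** Also used for real scalars, as [xy r 0], and for the imaginary unit, as [xy 0 1]. *)
Definition xy (x y : R) : C := (x +i* y)%C.

Lemma cmod_xy x y : cmod (xy x y) <= `|x| + `|y|.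
Proof. exact: ler_cmod_ReIm. Qed.

Lemma continuous_bounded f : continuous f ->
  forall M : R, exists N : R, forall z, cmod z <= M -> cmod (f z) <= N.
Proof.
(* The disc lies in the square of half-side [L], which is nondegenerate for every [M]. *)
move=> cf M; pose L := `|M| + 1.
have L0 : 0 < L by rewrite ltr_wpDl.
pose G a c w h := exists N, forall x y, a <= x <= a + w -> c <= y <= c + h ->
  cmod (f (xy x y)) <= N.
have LL : 0 < L + L by rewrite addr_gt0.
have [N NP] : G (- L) (- L) (L + L) (L + L).
  apply: rectangle_induction => //.
    move=> a c w h w0 h0 [N1 H1] [N2 H2] [N3 H3] [N4 H4].
    exists (Num.max (Num.max N1 N2) (Num.max N3 N4)).
    move=> x y /andP[ax xa] /andP[cy yc].
      rewrite !le_max; have [xw|xw] := leP x (a + w / 2);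
      have [yh|yh] := leP y (c + h / 2).
      + by rewrite H1// ?ax ?xw ?cy ?yh.
      + by rewrite H3 ?orbT//; apply/andP; split; lra.
      + by rewrite H2 ?orbT//; apply/andP; split; lra.
      + by rewrite H4 ?orbT//; apply/andP; split; lra.
  move=> x y _ _.
  have [d d0 dP] := (continuous_cplxP f (xy x y)).1 (cf _) _ ltr01.
  exists (d / 2 / (L + L)); first by rewrite !divr_gt0.
  move=> q a c /andP[q0]; rewrite ltr_pdivlMr// => qd ax xa cy yc.
  exists (cmod (f (xy x y)) + 1) => s t sa tc.
  have -> : f (xy s t) = f (xy x y) + (f (xy s t) - f (xy x y)).
  by rewrite addrC subrK.
  apply: (le_trans (ler_cmodD _ _)); rewrite lerD2l.
  have -> : xy s t = xy x y + xy (s - x) (t - y).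
  by congr Complex; rewrite addrC subrK.
  apply: dP; apply: le_lt_trans (cmod_xy _ _) _.
  rewrite [ltRHS](splitr d); apply: ltrD; rewrite ltr_norml; apply/andP; lra.
exists N => z zM; case: z zM => x y zM; apply: NP; have := ler_Re_cmod (xy x y);
have := ler_Im_cmod (xy x y); rewrite /= !ler_norml => /andP[? ?] /andP[? ?];
have Mn := ler_norm M; rewrite -/(xy x y) in zM; rewrite /L; apply/andP; split; lra.
Qed.

Lemma vertical_segment_equicontinuous f (x c h : R) : continuous f -> 0 < h ->
  forall e, 0 < e -> exists2 d, 0 < d & forall s t, `|s - x| < d ->
    c <= t <= c + h -> cmod (f (xy s t) - f (xy x t)) <= e.
Proof.
move=> cf h0 e e0.
pose G (a c w h : R) := exists2 d, 0 < d & forall s t, `|s - x| < d ->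
    c <= t <= c + h -> cmod (f (xy s t) - f (xy x t)) <= e.
(* The property depends on the vertical side only, so this two-dimensional induction subdivides just
   the segment. *)
apply: (@rectangle_induction R G 0 c 1 h) => //.
  move=> {c h h0} a c w h w0 h0 [d1 d10 H1] _ [d2 d20 H2] _.
  exists (Num.min d1 d2); first by rewrite lt_min d10.
  move=> s t; rewrite lt_min => /andP[sd1 sd2] /andP[ct tc].
  have [yh|yh] := leP t (c + h / 2); first by apply: H1; rewrite ?ct.
  by apply: H2 => //; apply/andP; split; lra.
move=> x' y _ _.
have e20 : 0 < e / 2 by rewrite divr_gt0.
have [d d0 dP] := (continuous_cplxP f (xy x y)).1 (cf _) _ e20.
exists (d / 2 / h); first by rewrite !divr_gt0.
move=> q a c' /andP[q0]; rewrite ltr_pdivlMr// => qd _ _ cy yc.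
exists (d / 2); first by rewrite divr_gt0.
move=> s t sx tc.
have -> : f (xy s t) - f (xy x t) = (f (xy s t) - f (xy x y)) -
    (f (xy x t) - f (xy x y)) by rewrite opprB addrA subrK.
apply: (le_trans (ler_cmodB _ _)); rewrite [leRHS]splitr.
have ty : `|t - y| < d / 2 by rewrite ltr_norml; apply/andP; lra.
have -> : xy s t = xy x y + xy (s - x) (t - y).
  by congr Complex; rewrite addrC subrK.
have -> : xy x t = xy x y + xy 0 (t - y).
  by congr Complex; rewrite ?addr0// addrC subrK.
apply: lerD; apply: dP; apply: le_lt_trans (cmod_xy _ _) _.
  by rewrite [ltRHS](splitr d) ltrD.
by rewrite normr0 add0r; lra.
Qed.

End CompactRectangles.

(** * Line integrals and Goursat's theorem *)

Section Goursat.
Variable R : realType.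
Local Notation C := (Cplx R).
Local Notation mu := (@lebesgue_measure R).
Local Notation Re := (@complex.Re R).
Local Notation Im := (@complex.Im R).
Implicit Types (f : C -> C) (p P : R -> C).

Lemma integral_is_derive (f : R -> R) (a x : R) : continuous f -> a < x ->
  is_derive x 1 (fun y => \int[mu]_(t in `[a, y]) f t) (f x).
Proof.
move=> cf ax; have := @continuous_FTC1_closed R f a x (x + 1).
have xx1 : x < x + 1 by rewrite ltrDl.
move=> /(_ xx1); case=> [||//|dF F'x].
- apply: continuous_compact_integrable; first exact: segment_compact.
  exact: continuous_subspaceT.
- exact: ax.
- exact: cf.
- by split; [exact: dF|rewrite -F'x derive1E].
Qed.

(** Taken componentwise, because the integrals and the mean value theorem behind it are those of
    real functions. *)
Definition is_cderive P (x : R) (d : C) :=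
  is_derive x (1 : R) (Re \o P : R -> R) (Re d) /\
  is_derive x (1 : R) (Im \o P : R -> R) (Im d).

Definition cint (a : R) p (x : R) : C :=
  xy (\int[mu]_(t in `[a, x]) Re (p t)) (\int[mu]_(t in `[a, x]) Im (p t)).

Lemma cint_is_cderive p (a x : R) : continuous (Re \o p) -> continuous (Im \o p) ->
  a < x -> is_cderive (cint a p) x (p x).
Proof. by move=> cR cI ax; split; exact: integral_is_derive. Qed.

Lemma is_cderiveB P1 P2 (x : R) (d1 d2 : C) :
  is_cderive P1 x d1 -> is_cderive P2 x d2 ->
  is_cderive (P1 \- P2) x (d1 - d2).
Proof.
have ReB (u v : C) : Re (u - v) = Re u - Re v by case: u v => [? ?] [].
have ImB (u v : C) : Im (u - v) = Im u - Im v by case: u v => [? ?] [].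
move=> [R1 I1] [R2 I2]; split.
  rewrite ReB [X in is_derive _ _ X](_ : _ = (Re \o P1) - (Re \o P2)).
    exact: is_deriveB.
  by apply/funext => t /=; rewrite ReB.
rewrite ImB [X in is_derive _ _ X](_ : _ = (Im \o P1) - (Im \o P2)).
  exact: is_deriveB.
by apply/funext => t /=; rewrite ImB.
Qed.

(** The mean value theorem is applied to [F] minus the primitive of [c + d * t]; this takes the
    place of estimates of integrals. *)
Lemma increment_near_affine (F f : R -> R) (a b c d M : R) : a <= b ->
  (forall t, a <= t <= b -> is_derive t 1 F (f t)) ->
  (forall t, a <= t <= b -> `|f t - (c + d * t)| <= M) ->
  `|F b - F a - (c * (b - a) + d * (b ^+ 2 - a ^+ 2) / 2)| <= M * (b - a).
Proof.
move=> ab dF fM.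
pose G t := F t - (c * t + d / 2 * t ^+ 2).
have dG t : a <= t <= b -> is_derive t 1 G (f t - (c + d * t)).
  move=> /dF Ft; rewrite /G; apply: is_derive_eq.
  by rewrite /GRing.scale/=; field.
have [||t tab Gab] := @MVT_segment R G (fun t => f t - (c + d * t)) a b ab.
- by move=> t; rewrite in_itv/= => /andP[/ltW at' /ltW tb]; apply: dG; rewrite at'.
- apply: derivable_within_continuous => t; rewrite in_itv/= => tab.
  by have [] := dG t tab.
have -> : F b - F a - (c * (b - a) + d * (b ^+ 2 - a ^+ 2) / 2) = G b - G a.
  by rewrite /G; field.
rewrite Gab normrM (ger0_norm (_ : 0 <= b - a)) ?subr_ge0//.
by apply: ler_wpM2r; rewrite ?subr_ge0// fM//; move: tab; rewrite in_itv.
Qed.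

(** Real and imaginary parts are estimated separately, hence the factor 2. *)
Lemma cincrement_near_affine P p (a b : R) (c d : C) (M : R) : a <= b ->
  (forall t, a <= t <= b -> is_cderive P t (p t)) ->
  (forall t, a <= t <= b -> cmod (p t - (c + d * xy t 0)) <= M) ->
  cmod (P b - P a - (c * xy (b - a) 0 + d * xy ((b ^+ 2 - a ^+ 2) / 2) 0))
    <= 2 * M * (b - a).
Proof.
move=> ab dP pM; apply: (le_trans (ler_cmod_ReIm _)).
rewrite -mulrA mulr_natl mulr2n; apply: lerD.
  have := @increment_near_affine (Re \o P) (Re \o p) a b (Re c) (Re d) M ab.
  have -> : Re (P b - P a - (c * xy (b - a) 0 + d * xy ((b ^+ 2 - a ^+ 2) / 2) 0))
      = (Re \o P) b - (Re \o P) a -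
        (Re c * (b - a) + Re d * (b ^+ 2 - a ^+ 2) / 2).
    rewrite /=; case: c d (P a) (P b) {pM} => [? ?] [? ?] [? ?] [? ?] /=.
    by rewrite !mulr0 !subr0 mulrA.
  apply; first by move=> t /dP[].
  move=> t /pM; apply: le_trans; apply: le_trans (ler_Re_cmod _).
  rewrite /=; case: c d (p t) {pM} => [? ?] [? ?] [? ?] /=.
  by rewrite !mulr0 !subr0.
have := @increment_near_affine (Im \o P) (Im \o p) a b (Im c) (Im d) M ab.
have -> : Im (P b - P a - (c * xy (b - a) 0 + d * xy ((b ^+ 2 - a ^+ 2) / 2) 0))
    = (Im \o P) b - (Im \o P) a -
      (Im c * (b - a) + Im d * (b ^+ 2 - a ^+ 2) / 2).
  rewrite /=; case: c d (P a) (P b) {pM} => [? ?] [? ?] [? ?] [? ?] /=.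
  by rewrite !mulr0 !add0r mulrA.
apply; first by move=> t /dP[].
move=> t /pM; apply: le_trans; apply: le_trans (ler_Im_cmod _).
rewrite /=; case: c d (p t) {pM} => [? ?] [? ?] [? ?] /=.
by rewrite !mulr0 !add0r.
Qed.

Lemma cincrement_bound P p (a b M : R) : a <= b ->
  (forall t, a <= t <= b -> is_cderive P t (p t)) ->
  (forall t, a <= t <= b -> cmod (p t) <= M) ->
  cmod (P b - P a) <= 2 * M * (b - a).
Proof.
move=> ab dP pM; have := @cincrement_near_affine P p a b 0 0 M ab dP.
by rewrite !mul0r addr0 subr0; apply => t /pM; rewrite !mul0r addr0 subr0.
Qed.

(** Here [z] parametrizes a line with speed at most 1 and increments [v]; horizontal, vertical and
    radial lines are all of this form. *)
Lemma continuous_ReIm_line f (z v : R -> C) : continuous f ->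
  (forall s t, z t = z s + v (t - s)) -> (forall t, cmod (v t) <= `|t|) ->
  continuous (Re \o (f \o z)) /\ continuous (Im \o (f \o z)).
Proof.
move=> cf zv v1.
have key (e x : R) : 0 < e ->
    \forall t \near x, cmod (f (z x) - f (z t)) <= e.
  move=> e0; have [d d0 dP] := (continuous_cplxP f (z x)).1 (cf _) _ e0.
  near=> t; rewrite cmodBC (zv x t); apply: dP; apply: le_lt_trans (v1 _) _.
  by rewrite distrC; near: t; exact: cvgr_dist_lt.
split=> x; apply/cvgrPdist_le => e /(key _ x); apply: filterS => t;
  apply: le_trans.
  have -> : (Re \o (f \o z)) x - (Re \o (f \o z)) t = Re (f (z x) - f (z t)).
    by rewrite /=; case: (f (z x)) (f (z t)) => [? ?] [].
  exact: ler_Re_cmod.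
have -> : (Im \o (f \o z)) x - (Im \o (f \o z)) t = Im (f (z x) - f (z t)).
  by rewrite /=; case: (f (z x)) (f (z t)) => [? ?] [].
exact: ler_Im_cmod.
Unshelve. all: by end_near.
Qed.

Lemma vertical_cint f (a x y : R) : continuous f -> a < y ->
  is_cderive (cint a (fun t => f (xy x t))) y (f (xy x y)).
Proof.
move=> cf ay; have [||cR cI] := @continuous_ReIm_line f (xy x) (xy 0) cf.
- by move=> s t; congr Complex; rewrite ?addr0// addrC subrK.
- by move=> t; rewrite (le_trans (cmod_xy _ _))// normr0 add0r.
- exact: cint_is_cderive.
Qed.

Lemma horizontal_cint f (a x y : R) : continuous f -> a < x ->
  is_cderive (cint a (fun s => f (xy s y))) x (f (xy x y)).
Proof.
move=> cf ax.
have [||cR cI] := @continuous_ReIm_line f (fun s => xy s y) (fun s => xy s 0) cf.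
- by move=> s t; congr Complex; rewrite ?addr0// addrC subrK.
- by move=> t; rewrite (le_trans (cmod_xy _ _))// normr0 addr0.
- exact: (@cint_is_cderive (fun s => f (xy s y))).
Qed.

End Goursat.

(** * Integrals over boundaries of rectangles *)

Section RectangleIntegral.
Variable R : realType.
Local Notation C := (Cplx R).
Implicit Types (f : C -> C) (A B a c w h x y : R).

(** As a difference of values of one primitive, the integral is additive over adjacent segments by
    pure algebra. *)
Definition hint f A y x1 x2 : C :=
  cint A (fun s => f (xy s y)) x2 - cint A (fun s => f (xy s y)) x1.

Definition vint f B x y1 y2 : C :=
  cint B (fun t => f (xy x t)) y2 - cint B (fun t => f (xy x t)) y1.

(* The base points A, B of the primitives only have to lie to the left of and
   below the rectangle. *)
Definition rect_int f A B a c w h : C :=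
  hint f A c a (a + w) + xy 0 1 * vint f B (a + w) c (c + h)
  - hint f A (c + h) a (a + w) - xy 0 1 * vint f B a c (c + h).

Lemma cplx_ext (u v : C) : complex.Re u = complex.Re v ->
  complex.Im u = complex.Im v -> u = v.
Proof. by case: u v => [? ?] [? ?] /= -> ->. Qed.

(** The terms are the exact integrals of [l + d * z] over the four sides: this is Cauchy's theorem
    for affine functions. *)
Lemma rect_int_affine (l d : C) a c w h :
  (l + d * xy 0 c) * xy w 0 + d * xy (((a + w) ^+ 2 - a ^+ 2) / 2) 0
  + xy 0 1 * ((l + d * xy (a + w) 0) * xy h 0 +
      d * xy 0 1 * xy (((c + h) ^+ 2 - c ^+ 2) / 2) 0)
  - ((l + d * xy 0 (c + h)) * xy w 0 + d * xy (((a + w) ^+ 2 - a ^+ 2) / 2) 0)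
  - xy 0 1 * ((l + d * xy a 0) * xy h 0 +
      d * xy 0 1 * xy (((c + h) ^+ 2 - c ^+ 2) / 2) 0) = 0.
Proof. by case: l d => [l1 l2] [d1 d2]; apply: cplx_ext => /=; field. Qed.

(** After subtraction of the vanishing integral of the affine function, each side contributes at
    most [2 * M] times its length. *)
Lemma rect_int_near_affine f A B a c w h (l d : C) (M : R) : continuous f ->
  A < a -> B < c -> 0 <= w -> 0 <= h ->
  (forall x y, a <= x <= a + w -> c <= y <= c + h ->
    cmod (f (xy x y) - (l + d * xy x y)) <= M) ->
  cmod (rect_int f A B a c w h) <= 4 * M * (w + h).
Proof.
move=> cf Aa Bc w0 h0 fM.
have aw : a <= a + w by rewrite lerDl.
have ch : c <= c + h by rewrite lerDl.
have wE : w = a + w - a by rewrite addrAC subrr add0r.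
have hE : h = c + h - c by rewrite addrAC subrr add0r.
have Hy y : c <= y <= c + h -> cmod (hint f A y a (a + w) -
    ((l + d * xy 0 y) * xy w 0 + d * xy (((a + w) ^+ 2 - a ^+ 2) / 2) 0))
    <= 2 * M * w.
  move=> cy; rewrite {2 4}wE.
  apply: (cincrement_near_affine (p := fun s => f (xy s y)) aw).
    by move=> s /andP[a_s _]; apply: horizontal_cint => //; exact: lt_le_trans a_s.
  move=> s asw; have -> : l + d * xy 0 y + d * xy s 0 = l + d * xy s y.
    by rewrite -addrA -mulrDr; congr (_ + _ * Complex _ _); rewrite ?add0r ?addr0.
  exact: fM.
have Vx x : a <= x <= a + w -> cmod (vint f B x c (c + h) -
    ((l + d * xy x 0) * xy h 0 +
      d * xy 0 1 * xy (((c + h) ^+ 2 - c ^+ 2) / 2) 0)) <= 2 * M * h.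
  move=> ax; rewrite {2 4}hE.
  apply: (cincrement_near_affine (p := fun t => f (xy x t)) ch).
    by move=> t /andP[ct _]; apply: vertical_cint => //; exact: lt_le_trans ct.
  move=> t cth; have -> : l + d * xy x 0 + d * xy 0 1 * xy t 0 = l + d * xy x t.
    by case: l d {fM Hy} => [l1 l2] [d1 d2]; apply: cplx_ext => /=; ring.
  exact: fM.
rewrite -[rect_int _ _ _ _ _ _ _]subr0 -(rect_int_affine l d a c w h) /rect_int.
have acw : a <= a <= a + w by rewrite lexx aw.
have acw' : a <= a + w <= a + w by rewrite lexx aw.
have cch : c <= c <= c + h by rewrite lexx ch.
have cch' : c <= c + h <= c + h by rewrite lexx ch.
have alg (H1 V1 H2 V2 X1 X3 X2 X4 i : C) :
    H1 + i * V1 - H2 - i * V2 - (X1 + i * X3 - X2 - i * X4) =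
    (H1 - X1) + i * (V1 - X3) - (H2 - X2) - i * (V2 - X4) by ring.
have cmodi (u : C) : cmod (xy 0 1 * u) = cmod u.
  rewrite cmodM; suff -> : cmod (xy (0 : R) 1) = 1 by rewrite mul1r.
  by rewrite /cmod /= expr0n expr1n add0r sqrtr1.
have tri (u1 u2 u3 u4 : C) (m n : R) : cmod u1 <= m -> cmod u2 <= n ->
    cmod u3 <= m -> cmod u4 <= n ->
    cmod (u1 + xy 0 1 * u2 - u3 - xy 0 1 * u4) <= m + n + m + n.
  move=> um1 un2 um3 un4.
  apply: (le_trans (ler_cmodB _ _)); rewrite cmodi lerD//.
  apply: (le_trans (ler_cmodB _ _)); rewrite lerD//.
  by apply: (le_trans (ler_cmodD _ _)); rewrite cmodi lerD.
rewrite alg; apply: le_trans (tri _ _ _ _ _ _ (Hy _ cch) (Vx _ acw')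
  (Hy _ cch') (Vx _ acw)) _; lra.
Qed.

(** Inner sides are traversed twice in opposite directions and cancel. *)
Lemma rect_int_quarters f A B a c w h :
  rect_int f A B a c w h =
  rect_int f A B a c (w / 2) (h / 2) +
  rect_int f A B (a + w / 2) c (w / 2) (h / 2) +
  rect_int f A B a (c + h / 2) (w / 2) (h / 2) +
  rect_int f A B (a + w / 2) (c + h / 2) (w / 2) (h / 2).
Proof.
have ww : a + w / 2 + w / 2 = a + w by field.
have hh : c + h / 2 + h / 2 = c + h by field.
have hsplit y : hint f A y a (a + w) =
    hint f A y a (a + w / 2) + hint f A y (a + w / 2) (a + w).
  by rewrite /hint [RHS]addrC addrA subrK.
have vsplit x : vint f B x c (c + h) =
    vint f B x c (c + h / 2) + vint f B x (c + h / 2) (c + h).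
  by rewrite /vint [RHS]addrC addrA subrK.
rewrite /rect_int ww hh !hsplit !vsplit.
move: (hint f A) (vint f B) => H V; ring.
Qed.

(** Rectangle induction on a bound proportional to the area. Such bounds add up over the quarters,
    and locally differentiability makes [f] affine up to an error small against the size of the
    rectangle. *)
Lemma goursat f A B a c w h : continuous f -> A < a -> B < c -> 0 < w -> 0 < h ->
  (forall x y, a <= x <= a + w -> c <= y <= c + h -> derivable f (xy x y) 1) ->
  rect_int f A B a c w h = 0.
Proof.
move=> cf Aa Bc w0 h0 df; apply/eqP; rewrite -cmod_eq0 eq_le cmod_ge0 andbT.
apply/ler_addgt0Pr => e e0; rewrite add0r.
pose k := e / (w * h); have k0 : 0 < k by rewrite divr_gt0// mulr_gt0.
have -> : e = k * (w * h) by rewrite divfK// mulf_neq0// gt_eqF.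
apply: (@rectangle_induction R
    (fun a c w h => cmod (rect_int f A B a c w h) <= k * (w * h))) => //.
  move=> a1 c1 w1 h1 w10 h10 I1 I2 I3 I4; rewrite rect_int_quarters.
  have -> : k * (w1 * h1) = k * (w1 / 2 * (h1 / 2)) + k * (w1 / 2 * (h1 / 2)) +
      k * (w1 / 2 * (h1 / 2)) + k * (w1 / 2 * (h1 / 2)) by field.
  by do 3![apply: (le_trans (ler_cmodD _ _)); rewrite lerD//].
move=> x y ax cy.
(* On a rectangle scaled by [q] the error is at most [m * q * (w + h)], so the integral is at most
   [4 * m * q ^+ 2 * (w + h) ^+ 2]; this [m] makes that equal to [k] times the area. *)
pose m := k * (w * h) / (4 * (w + h) ^+ 2).
have wh0 : 0 < w + h by rewrite addr_gt0.
have m0 : 0 < m.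
  by apply: divr_gt0; [rewrite mulr_gt0// mulr_gt0|rewrite mulr_gt0// exprn_gt0].
have [d dP] := (derivable_cplxP f (xy x y)).1 (df _ _ ax cy).
have [r r0 rP] := dP _ m0.
exists (r / (w + h)); first by rewrite divr_gt0.
move=> q a' c' /andP[q0]; rewrite ltr_pdivlMr// => qr.
move=> /andP[aa' a'x] /andP[xa' a'a] /andP[cc' c'y] /andP[yc' c'c].
have qw0 : 0 < q * w by rewrite mulr_gt0.
have qh0 : 0 < q * h by rewrite mulr_gt0.
have -> : k * (q * w * (q * h)) = 4 * (m * (q * (w + h))) * (q * w + q * h).
  by rewrite /m; field; rewrite gt_eqF.
apply: (@rect_int_near_affine _ _ _ _ _ _ _ (f (xy x y) - d * xy x y) d) => //.
- exact: lt_le_trans aa'.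
- exact: lt_le_trans cc'.
- exact: ltW.
- exact: ltW.
move=> s t /andP[s1 s2] /andP[t1 t2].
have st : cmod (xy (s - x) (t - y)) <= q * (w + h).
  rewrite (le_trans (cmod_xy _ _))// mulrDr; apply: lerD; rewrite ler_norml;
  apply/andP; split; lra.
have -> : f (xy s t) - (f (xy x y) - d * xy x y + d * xy s t) =
    f (xy x y + xy (s - x) (t - y)) - f (xy x y) - d * xy (s - x) (t - y).
  have -> : xy x y + xy (s - x) (t - y) = xy s t.
    by apply: cplx_ext => /=; rewrite addrC subrK.
  have -> : xy (s - x) (t - y) = xy s t - xy x y by [].
  by ring.
apply: le_trans (rP _ _) _; first exact: le_lt_trans st qr.
by rewrite ler_pM2l.
Qed.

End RectangleIntegral.

(** * Means of periodic functions over vertical periods *)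

Section PeriodicFunctions.
Variable R : realType.
Local Notation C := (Cplx R).
Implicit Types (f : C -> C) (B h s x : R).

Lemma vint_near_constant f B x h (l : C) (M : R) : continuous f -> B < 0 -> 0 < h ->
  (forall y, 0 <= y <= h -> cmod (f (xy x y) - l) <= M) ->
  cmod (vint f B x 0 h - l * xy h 0) <= 2 * M * h.
Proof.
move=> cf B0 h0 fM.
have := @cincrement_near_affine R (cint B (fun t => f (xy x t)))
  (fun t => f (xy x t)) 0 h l 0 M (ltW h0).
rewrite !mul0r addr0 subr0 => -> //.
  by move=> y /andP[y0 _]; apply: vertical_cint => //; exact: lt_le_trans y0.
by move=> y /fM; rewrite mul0r addr0.
Qed.

Lemma vint_near f B x s h (M : R) : continuous f -> B < 0 -> 0 < h ->
  (forall y, 0 <= y <= h -> cmod (f (xy s y) - f (xy x y)) <= M) ->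
  cmod (vint f B s 0 h - vint f B x 0 h) <= 2 * M * h.
Proof.
move=> cf B0 h0 fM.
have -> : vint f B s 0 h - vint f B x 0 h =
    (cint B (fun t => f (xy s t)) \- cint B (fun t => f (xy x t))) h -
    (cint B (fun t => f (xy s t)) \- cint B (fun t => f (xy x t))) 0.
  by rewrite /vint /=; ring.
rewrite -{2}[h]subr0.
apply: (cincrement_bound (p := fun y => f (xy s y) - f (xy x y))) => //.
  exact: ltW.
move=> y /andP[y0 _]; apply: is_cderiveB; apply: vertical_cint => //;
  exact: lt_le_trans y0.
Qed.

(** On a rectangle whose height is the period the horizontal sides cancel, and Goursat's theorem
    equates the vertical ones. *)
Lemma vint_periodic f B h s1 s2 : continuous f -> B < 0 -> 0 < h ->
  (forall z, f (z + xy 0 h) = f z) -> s1 < s2 ->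
  (forall x y, s1 <= x <= s2 -> derivable f (xy x y) 1) ->
  vint f B s1 0 h = vint f B s2 0 h.
Proof.
move=> cf B0 h0 fh s12 df.
have sE : s1 + (s2 - s1) = s2 by rewrite addrC subrK.
have : rect_int f (s1 - 1) B s1 0 (s2 - s1) h = 0.
  apply: goursat => //.
  - by rewrite ltrBlDr ltrDl.
  - by rewrite subr_gt0.
  - by move=> x y; rewrite sE => sx _; exact: df.
rewrite /rect_int sE add0r.
have -> : hint f (s1 - 1) h s1 s2 = hint f (s1 - 1) 0 s1 s2.
  rewrite /hint; suff -> : (fun s => f (xy s h)) = (fun s => f (xy s 0)) by [].
  apply/funext => s; rewrite -(fh (xy s 0)); congr f.
  by apply: cplx_ext => /=; rewrite ?addr0 ?add0r.
have alg (i u v v' : C) : u + i * v - u - i * v' = i * (v - v') by ring.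
rewrite alg => /eqP; rewrite mulf_eq0 subr_eq0.
case/orP => [/eqP[/eqP]|/eqP->//]; by rewrite oner_eq0.
Qed.

Lemma vint_periodic_left f B h s0 s1 s2 : continuous f -> B < 0 -> 0 < h ->
  (forall z, f (z + xy 0 h) = f z) ->
  (forall x y, x < s0 -> derivable f (xy x y) 1) -> s1 < s0 -> s2 < s0 ->
  vint f B s1 0 h = vint f B s2 0 h.
Proof.
move=> cf B0 h0 fh df s10 s20; case: (ltgtP s1 s2) => [s12|s12|-> //].
  by apply: vint_periodic => // x y /andP[_ xs]; apply: df; exact: le_lt_trans s20.
by apply/esym/vint_periodic => // x y /andP[_ xs]; apply: df; exact: le_lt_trans s10.
Qed.

Lemma vint_periodic_right f B h s0 s1 s2 : continuous f -> B < 0 -> 0 < h ->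
  (forall z, f (z + xy 0 h) = f z) ->
  (forall x y, s0 < x -> derivable f (xy x y) 1) -> s0 < s1 -> s0 < s2 ->
  vint f B s1 0 h = vint f B s2 0 h.
Proof.
move=> cf B0 h0 fh df s10 s20; case: (ltgtP s1 s2) => [s12|s12|-> //].
  by apply: vint_periodic => // x y /andP[xs _]; apply: df; exact: lt_le_trans xs.
by apply/esym/vint_periodic => // x y /andP[xs _]; apply: df; exact: lt_le_trans xs.
Qed.

(* The means over the vertical period segments do not depend on the abscissa;
   across the exceptional line this is by continuity. *)
Lemma periodic_limits f h s0 (l : C) : continuous f -> 0 < h ->
  (forall z, f (z + xy 0 h) = f z) ->
  (forall x y, x != s0 -> derivable f (xy x y) 1) ->
  (forall e, 0 < e -> exists s, forall x y, s <= x -> cmod (f (xy x y)) <= e) ->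
  (forall e, 0 < e -> exists s, forall x y, x <= s -> cmod (f (xy x y) - l) <= e) ->
  l = 0.
Proof.
move=> cf h0 fh df right0 leftl.
pose J s := vint f (-1) s 0 h.
have N10 : -1 < 0 :> R by rewrite oppr_lt0.
have small (u : C) : (forall e, 0 < e -> cmod u <= 2 * e * h) -> u = 0.
  move=> ue; apply/eqP; rewrite -cmod_eq0 eq_le cmod_ge0 andbT.
  apply/ler_addgt0Pr => e e0; rewrite add0r.
  have -> : e = 2 * (e / (2 * h)) * h by field; rewrite gt_eqF.
  by apply: ue; rewrite divr_gt0// mulr_gt0.
have J_right s : s0 < s -> J s = 0.
  move=> s0s; apply: small => e /right0[s' s'P].
  pose t := Num.max s s'.
  have -> : J s = J t.
    apply: (@vint_periodic_right _ _ _ s0) => //; last by rewrite lt_max s0s.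
    by move=> x y s0x; apply: df; rewrite gt_eqF.
  have := @vint_near_constant f (-1) t h 0 e cf N10 h0.
  rewrite mul0r subr0; apply => y _; rewrite subr0.
  by apply: s'P; rewrite le_max lexx orbT.
have J_left s : s < s0 -> J s = l * xy h 0.
  move=> s0s; apply/eqP; rewrite -subr_eq0; apply/eqP.
  apply: small => e /leftl[s' s'P].
  pose t := Num.min s s'.
  have -> : J s = J t.
    apply: (@vint_periodic_left _ _ _ s0) => //; last by rewrite gt_min s0s.
    by move=> x y s0x; apply: df; rewrite lt_eqF.
  apply: vint_near_constant => // y _.
  by apply: s'P; rewrite ge_min lexx orbT.
have J_cont e : 0 < e -> exists2 d, 0 < d &
    forall s, `|s - s0| < d -> cmod (J s - J s0) <= 2 * e * h.
  move=> e0; have [d d0 dP] := vertical_segment_equicontinuous s0 0 cf h0 e0.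
  exists d => // s sd; apply: vint_near => // y yh.
  by apply: dP; rewrite // add0r.
(* [J] is 0 to the right of [s0] and [l * xy h 0] to the left; continuity at [s0] identifies both
   values with [J s0]. *)
have J0 : J s0 = 0.
  apply: small => e /J_cont[d d0 dP].
  rewrite -cmodN -[- J s0]add0r -(J_right (s0 + d / 2)); last first.
    by rewrite ltrDl divr_gt0.
  by apply: dP; rewrite addrAC subrr add0r gtr0_norm ?divr_gt0//; lra.
have : l * xy h 0 = 0.
  apply: small => e /J_cont[d d0 dP].
  rewrite -[_ * _]subr0 -J0 -(J_left (s0 - d / 2)); last first.
    by rewrite ltrBlDr ltrDl divr_gt0.
  by apply: dP; rewrite addrAC subrr add0r normrN gtr0_norm ?divr_gt0//; lra.
move/eqP; rewrite mulf_eq0 => /orP[/eqP//|/eqP[/eqP]].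
by rewrite gt_eqF.
Qed.

End PeriodicFunctions.

(** * The complex exponential and Liouville's theorem *)

Section Exponential.
Variable R : realType.
Local Notation C := (Cplx R).
Implicit Types (z w : C).

Lemma is_derive_realP (f : R -> R) (x d : R) : is_derive x 1 f d <->
  forall e, 0 < e -> exists2 r, 0 < r &
    forall h, `|h| < r -> `|f (x + h) - f x - d * h| <= e * `|h|.
Proof.
have expand (h e' : R) : h != 0 -> `|h^-1 *: (f (h *: 1 + x) - f x) - d| <= e' =
    (`|f (x + h) - f x - d * h| <= e' * `|h|).
  move=> h0; rewrite -ler_pdivrMr ?normr_gt0// -normfV -normrM mulrBl mulfK//.
  by rewrite [_ *: 1]mulr1 (addrC x) [_ *: _]mulrC.
split.
  move=> [fx fd] e e0.
  have : h^-1 *: ((f \o shift x) (h *: 1) - f x) @[h --> 0^'] --> d.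
    by rewrite -fd; exact: fx.
  move/cvgrPdist_le => /(_ e e0)/nbhs_ballP[r /= r0 rP].
  exists r => // h hr; have [->|h0] := eqVneq h 0.
    by rewrite addr0 subrr sub0r mulr0 oppr0 normr0 mulr0.
  rewrite -expand// distrC; apply: rP => //.
  by rewrite -ball_normE /= sub0r normrN.
move=> dP; have cvgd : h^-1 *: ((f \o shift x) (h *: 1) - f x) @[h --> 0^'] --> d.
  apply/cvgrPdist_le => e /dP[r r0 rP]; apply/nbhs_ballP; exists r => //= h.
  rewrite -ball_normE /= sub0r normrN => hr h0.
  by rewrite distrC expand// rP.
by apply: DeriveDef; [apply/cvg_ex; exists d|exact/cvg_lim].
Qed.

Definition cexp z : C :=
  xy (expR (complex.Re z) * cos (complex.Im z))
     (expR (complex.Re z) * sin (complex.Im z)).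

Lemma cexpD z w : cexp (z + w) = cexp z * cexp w.
Proof.
by case: z w => [a b] [c d]; apply: cplx_ext => /=; rewrite expRD ?cosD ?sinD; ring.
Qed.

Lemma cexp_periodic z : cexp (z + xy 0 (pi *+ 2)) = cexp z.
Proof. by case: z => a b; rewrite /cexp /= addr0 sinD2pi cosD2pi. Qed.

Lemma cmod_cexp z : cmod (cexp z) = expR (complex.Re z).
Proof.
rewrite /cmod /= !exprMn -mulrDr cos2Dsin2 mulr1 sqrtr_sqr ger0_norm//.
Qed.

Lemma cexp_neq0 z : cexp z != 0.
Proof. by rewrite -cmod_gt0 cmod_cexp expR_gt0. Qed.

(** By the addition formula, differentiability everywhere reduces to this expansion at 0, which
    comes from those of [expR], [cos] and [sin]. *)
Lemma cexp_expansion0 (e : R) : 0 < e -> exists2 r : R, 0 < r &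
  forall h, cmod h < r -> cmod (cexp h - 1 - h) <= e * cmod h.
Proof.
(* The three summands below are at most 4, 1 and 1 times [n * m], whence [e / 6]. *)
move=> e0; pose n := Num.min 1 (e / 6).
have n0 : 0 < n by rewrite lt_min ltr01 divr_gt0.
have n1 : n <= 1 by rewrite ge_min lexx.
have n6 : n <= e / 6 by rewrite ge_min lexx orbT.
have [r1 r10 exp_r1] := (is_derive_realP _ _ _).1 (is_derive_expR (0 : R)) _ n0.
have [r2 r20 cos_r2] := (is_derive_realP _ _ _).1 (is_derive_cos (0 : R)) _ n0.
have [r3 r30 sin_r3] := (is_derive_realP _ _ _).1 (is_derive_sin (0 : R)) _ n0.
(* The entry [n / 2] gives [2 * |a| <= n <= 1], which bounds [expR a] by 2 and the mixed term by
   [n * m]. *)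
pose r := Num.min (Num.min r1 r2) (Num.min r3 (n / 2)).
exists r; first by rewrite !lt_min r10 r20 r30 divr_gt0.
move=> [a b] hr.
have := ler_Re_cmod (xy a b); have := ler_Im_cmod (xy a b).
rewrite -/(xy a b) in hr *; set m := cmod _ in hr *.
move: hr; rewrite !lt_min => /andP[/andP[mr1 mr2] /andP[mr3 mn]] bm am.
rewrite /= in am bm.
have := exp_r1 a (le_lt_trans am mr1); have := cos_r2 b (le_lt_trans bm mr2).
have := sin_r3 b (le_lt_trans bm mr3).
rewrite !add0r sin0 cos0 expR0 oppr0 mul0r !addr0 !subr0 !mul1r => Es Ec Ee.
(* This is [e^a (e^(ib) - 1 - ib) + (e^a - 1 - a) + ib (e^a - 1)]. *)
have -> : cexp (xy a b) - 1 - xy a b =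
    xy (expR a) 0 * xy (cos b - 1) (sin b - b) + xy (expR a - 1 - a) 0 +
    xy 0 (b * (expR a - 1)).
  by apply: cplx_ext => /=; ring.
have na : n * `|a| <= `|a| by rewrite -[leRHS]mul1r ler_wpM2r.
have Ea : `|expR a - 1| <= 2 * `|a|.
  have -> : expR a - 1 = (expR a - 1 - a) + a by rewrite subrK.
  by rewrite (le_trans (ler_normD _ _))// mulr_natl mulr2n lerD// (le_trans Ee).
have E2 : `|expR a| <= 2.
  have -> : expR a = (expR a - 1) + 1 by rewrite subrK.
  rewrite (le_trans (ler_normD _ _))// normr1; lra.
have nb : n * `|b| <= n * m by rewrite ler_pM2l.
have nam : n * `|a| <= n * m by rewrite ler_pM2l.
have nm6 : n * m <= e / 6 * m by rewrite ler_wpM2r// cmod_ge0.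
have T1 : cmod (xy (expR a) 0 * xy (cos b - 1) (sin b - b)) <= 4 * (n * m).
  rewrite cmodM; have -> : cmod (xy (expR a) 0) = `|expR a| by exact: cmod_real.
  have -> : 4 * (n * m) = 2 * (n * m + n * m) by ring.
  apply: ler_pM => //; first exact: cmod_ge0.
  by rewrite (le_trans (cmod_xy _ _))// lerD//; exact: le_trans nb.
have T2 : cmod (xy (expR a - 1 - a) 0) <= n * m.
  by rewrite (le_trans (cmod_xy _ _))// normr0 addr0 (le_trans Ee).
have T3 : cmod (xy 0 (b * (expR a - 1))) <= n * m.
  rewrite (le_trans (cmod_xy _ _))// normr0 add0r normrM mulrC.
  by apply: ler_pM => //; rewrite (le_trans Ea)//; lra.
rewrite (le_trans (ler_cmodD _ _))//.
have := ler_cmodD (xy (expR a) 0 * xy (cos b - 1) (sin b - b))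
  (xy (expR a - 1 - a) 0).
lra.
Qed.

Lemma derivable_cexp z : derivable cexp z 1.
Proof.
apply/derivable_cplxP; exists (cexp z) => e e0.
have z0 : 0 < cmod (cexp z) by rewrite cmod_gt0 cexp_neq0.
have [r r0 rP] := cexp_expansion0 (divr_gt0 e0 z0).
exists r => // h /rP hr.
have -> : cexp (z + h) - cexp z - cexp z * h = cexp z * (cexp h - 1 - h).
  by rewrite cexpD; ring.
by rewrite cmodM mulrC -ler_pdivlMr// mulrAC.
Qed.

End Exponential.

(** * Composition and continuity of differentiable functions *)

Section FieldDerivatives.
Variable K : numFieldType.
Implicit Types f g : K -> K.

Lemma derivable1_comp f g (z : K) : derivable f z 1 -> derivable g (f z) 1 ->
  derivable (g \o f) z 1.
Proof.
move=> /derivable1_diffP df /derivable1_diffP dg.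
by apply/derivable1_diffP; exact: differentiable_comp.
Qed.

Lemma derivable1_continuous f (z : K) : derivable f z 1 -> {for z, continuous f}.
Proof. by move=> /derivable1_diffP; exact: differentiable_continuous. Qed.

End FieldDerivatives.

(** * Liouville's theorem for functions of sublinear growth *)

Section Liouville.
Variable R : realType.
Local Notation C := (Cplx R).
Implicit Types (z w : C) (f g F : C -> C).

(** In the coordinate [w + e^z] the difference quotient of [F] at [w] is periodic, tends to [d] on
    the left and to 0 on the right, so [periodic_limits] applies. *)
Lemma sublinear_derive_eq0 F w (d : C) : w != 0 -> continuous F ->
  (forall z, z != 0 -> derivable F z 1) ->
  (forall e : R, 0 < e -> exists M : R, forall z, M <= cmod z ->
    cmod (F z) <= e * cmod z) ->
  (forall e : R, 0 < e -> exists2 r : R, 0 < r &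
    forall h, cmod h < r -> cmod (F (w + h) - F w - d * h) <= e * cmod h) ->
  d = 0.
Proof.
move=> w0 cF dF subF dP.
pose f z := (F (w + cexp z) - F w) / cexp z.
have w_cexp z : derivable (fun z => w + cexp z) z 1.
  apply: (@derivableD _ _ _ (cst w) (@cexp R)); first exact: derivable_cst.
  exact: derivable_cexp.
have inv_cexp z : derivable (fun z => (cexp z)^-1) z 1.
  by apply: derivableV; [exact: cexp_neq0|exact: derivable_cexp].
have cf : continuous f.
  move=> z; apply: (@continuousM _ _ (fun z => F (w + cexp z) - F w)).
    apply: (@continuousB _ _ _ (F \o (fun z => w + cexp z)) (cst (F w))).
      by apply: continuous_comp; [exact: derivable1_continuous|exact: cF].
    exact: cst_continuous.
  exact: derivable1_continuous.
(* [w + cexp z] can reach 0, where [F] need not be differentiable, only when the real part of [z] is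
   [ln (cmod w)]. *)
have df x y : x != ln (cmod w) -> derivable f (xy x y) 1.
  move=> xw; apply: (@derivableM _ _ (fun z => F (w + cexp z) - F w)) => //.
  apply: (@derivableB _ _ _ (F \o (fun z => w + cexp z)) (cst (F w))); last first.
    exact: derivable_cst.
  apply: derivable1_comp => //; apply: dF; apply: contra xw.
  rewrite addrC addr_eq0 => /eqP cw.
  by rewrite -(cmodN w) -cw cmod_cexp expRK.
apply: (@periodic_limits R f (pi *+ 2) (ln (cmod w))) => //.
- by rewrite mulrn_wgt0// pi_gt0.
- by move=> z; rewrite /f cexp_periodic.
- move=> e e0; have e30 : 0 < e / 3 by rewrite divr_gt0.
  have [M MP] := subF _ e30.
  (* Since [cmod E >= s], the first entry gives [cmod (w + E) >= M], the second
     [cmod (w + E) <= 2 * cmod E], and the third bounds [cmod (F w)] by [e / 3 * cmod E]. *)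
  pose s := Num.max (M + cmod w) (Num.max (cmod w) (cmod (F w) / (e / 3))).
  exists s => x y sx; set E := cexp (xy x y).
  have E0 : 0 < cmod E by rewrite cmod_gt0 cexp_neq0.
  have sE : s <= cmod E.
    rewrite cmod_cexp; apply: le_trans sx _; apply: le_trans (expR_ge1Dx x).
    by rewrite lerDr.
  move: sE; rewrite !ge_max => /andP[sE1 /andP[sE2]].
  rewrite ler_pdivrMr// => sE3.
  rewrite cmodM cmodV ler_pdivrMr//.
  have EwE : cmod E <= cmod (w + E) + cmod w.
    by have := ler_cmodB (w + E) w; rewrite (addrC w) addrK.
  have /MP Fw : M <= cmod (w + E) by rewrite -(lerD2r (cmod w)) (le_trans sE1).
  have wE := ler_cmodD w E.
  have := ler_cmodB (F (w + E)) (F w).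
  have wE2 : e / 3 * cmod (w + E) <= e / 3 * (cmod E + cmod E).
    by rewrite ler_pM2l// (le_trans wE)// lerD2r.
  lra.
- move=> e /dP[r r0 rP]; have r20 : 0 < r / 2 by rewrite divr_gt0.
  exists (ln (r / 2)) => x y xr; set E := cexp (xy x y).
  have E0 : E != 0 by exact: cexp_neq0.
  have -> : f (xy x y) - d = (F (w + E) - F w - d * E) / E.
    by rewrite mulrBl mulfK.
  rewrite cmodM cmodV ler_pdivrMr ?cmod_gt0//; apply: rP.
  rewrite cmod_cexp; apply: le_lt_trans (_ : r / 2 < r); last by lra.
  by rewrite -[leRHS]lnK ?posrE// ler_expR.
Qed.

(** The derivative vanishes off 0. The mean value theorem on the segment from 0 to [z], applied to
    real and imaginary parts, asks for it on the open segment and for continuity at the ends. *)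
Lemma liouville_sublinear F : continuous F ->
  (forall z, z != 0 -> derivable F z 1) ->
  (forall e : R, 0 < e -> exists M : R, forall z, M <= cmod z ->
    cmod (F z) <= e * cmod z) ->
  forall z, F z = F 0.
Proof.
move=> cF dF subF z; have [->//|z0] := eqVneq z 0.
have nz0 : 0 < cmod z by rewrite cmod_gt0.
pose u := z / xy (cmod z) 0.
have modxy (t : R) : cmod (xy t 0) = `|t| by exact: cmod_real.
have u1 : cmod u = 1.
  by rewrite cmodM cmodV modxy gtr0_norm// divff// gt_eqF.
have [||cRe cIm] := @continuous_ReIm_line R F (fun t => xy t 0 * u)
  (fun t => xy t 0 * u) cF.
- by move=> s t; rewrite -mulrDl; congr (_ * _); apply: cplx_ext => /=;
    rewrite ?addr0// addrC subrK.
- by move=> t; rewrite cmodM u1 mulr1 modxy.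
have flat (t e : R) : 0 < t -> 0 < e -> exists2 r, 0 < r & forall h : R, `|h| < r ->
    cmod (F (xy (t + h) 0 * u) - F (xy t 0 * u)) <= e * `|h|.
  move=> t0 e0.
  have tu0 : xy t 0 * u != 0 by rewrite -cmod_gt0 cmodM u1 mulr1 modxy gtr0_norm.
  have [d dP] := (derivable_cplxP F _).1 (dF _ tu0).
  have d0 := sublinear_derive_eq0 tu0 cF dF subF dP.
  have [r r0 rP] := dP _ e0; exists r => // h hr.
  have := rP (xy h 0 * u); rewrite cmodM u1 mulr1 modxy d0 mul0r subr0 => /(_ hr).
  rewrite -mulrDl; have -> : xy t 0 + xy h 0 = xy (t + h) 0.
    by apply: cplx_ext => //=; rewrite addr0.
  by [].
have const (g : C -> R) : (forall a b, g (a - b) = g a - g b) ->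
    (forall a, `|g a| <= cmod a) -> 
    continuous (g \o (F \o (fun t => xy t 0 * u))) -> g (F z) = g (F 0).
  move=> gB g1 cg.
  have [||c _] := @MVT_segment R (g \o (F \o (fun t => xy t 0 * u))) (cst 0)
      0 (cmod z) (ltW nz0).
  - move=> t; rewrite in_itv/= => /andP[t0 _]; apply/is_derive_realP => e e0.
    have [r r0 rP] := flat _ _ t0 e0; exists r => // h /rP.
    by rewrite mul0r subr0 /= -gB; apply: le_trans.
  - exact: continuous_subspaceT.
  rewrite mul0r /= => /eqP; rewrite subr_eq0 => /eqP.
  rewrite -[xy 0 0]/(0 : C) mul0r => <-; congr (g (F _)).
  by rewrite /u mulrC divfK// -cmod_eq0 modxy normr_eq0 gt_eqF.
apply: cplx_ext; apply: const => //.
- by move=> [? ?] [? ?].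
- exact: ler_Re_cmod.
- by move=> [? ?] [? ?].
- exact: ler_Im_cmod.
Qed.

End Liouville.

(** * Entire maps: dense images and left inverses *)

Section EntireMaps.
Variable R : realType.
Local Notation C := (Cplx R).
Implicit Types (z w a b c : C) (f g h k : C -> C).

Definition nonconstant f := forall c, exists z, f z != c.

Lemma entire_continuous f : entire f -> continuous f.
Proof. by move=> ef z; exact: derivable1_continuous. Qed.

Lemma entire_id : entire (@id C).
Proof. by move=> z; exact: derivable_id. Qed.

Lemma entire_comp f g : entire f -> entire g -> entire (f \o g).
Proof. by move=> ef eg z; exact: derivable1_comp. Qed.

(** If the values of [f] stayed away from [a], then [1 / (f - a)] would be entire and bounded, hence
    constant. *)
Lemma entire_dense_image f : entire f -> nonconstant f ->
  forall a (e : R), 0 < e -> exists z, cmod (f z - a) < e.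
Proof.
move=> ef ncf a e e0; apply: contrapT => nex.
have fa z : e <= cmod (f z - a).
  by rewrite leNgt; apply/negP => ?; apply: nex; exists z.
have fa0 z : f z - a != 0 by rewrite -cmod_gt0 (lt_le_trans e0).
have [z /eqP] := ncf (f 0); apply.
pose F z := (f z - a)^-1.
have eF : entire F.
  move=> w; apply: derivableV; first exact: fa0.
  by apply: derivableB; [exact: ef|exact: derivable_cst].
have subF (d : R) : 0 < d -> exists M : R, forall w, M <= cmod w ->
    cmod (F w) <= d * cmod w.
  move=> d0; exists (e^-1 / d) => w; rewrite ler_pdivrMr// mulrC.
  by apply: le_trans; rewrite cmodV lef_pV2 ?posrE// (lt_le_trans e0).
have dF w : w != 0 -> derivable F w 1 by move=> _; exact: eF.
have := @liouville_sublinear R F (entire_continuous eF) dF subF z.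
by move/invr_inj/addIr.
Qed.

(** [f] and [k] agree on the dense image of [g], so by continuity everywhere. *)
Lemma eq_comp_nonconstant f k g : continuous f -> continuous k ->
  entire g -> nonconstant g -> f \o g = k \o g -> f = k.
Proof.
move=> cf ck eg ncg fkg; apply/funext => w; apply/eqP.
rewrite -subr_eq0 -cmod_eq0 eq_le cmod_ge0 andbT.
apply/ler_addgt0Pr => e e0; rewrite add0r.
have e20 : 0 < e / 2 by rewrite divr_gt0.
have [d1 d10 fP] := (continuous_cplxP f w).1 (cf w) _ e20.
have [d2 d20 kP] := (continuous_cplxP k w).1 (ck w) _ e20.
have [|z] := entire_dense_image eg ncg w (e := Num.min d1 d2).
  by rewrite lt_min d10.
rewrite lt_min => /andP[/fP fz /kP kz].
have -> : f w - k w = (k (g z) - k w) - (f (g z) - f w).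
  by have /= -> := congr1 (@^~ z) fkg; ring.
apply: (le_trans (ler_cmodB _ _)); rewrite [leRHS]splitr.
by move: fz kz; rewrite (addrC w) subrK => fz kz; rewrite lerD.
Qed.

(** If [f \o g] were constant, cancelling [g] on the right would make [f] constant. *)
Lemma nonconstant_comp f g : entire f -> entire g ->
  nonconstant f -> nonconstant g -> nonconstant (f \o g).
Proof.
move=> ef eg ncf ncg c; apply: contrapT => nex.
have [z /eqP] := ncf c; apply.
suff -> : f = cst c by [].
apply: (eq_comp_nonconstant _ _ eg ncg); first exact: entire_continuous.
  exact: cst_continuous.
by apply/funext => w; apply/eqP; apply/negP => /negP fgw; apply: nex; exists w.
Qed.

Lemma iter_entire f n : entire f -> entire (iter n f).
Proof. by move=> ef; elim: n => [|n IH]; [exact: entire_id|exact: entire_comp]. Qed.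

Lemma nonconstant_id : nonconstant (@id C).
Proof.
by move=> c; exists (c + 1); rewrite -subr_eq0 addrAC subrr add0r oner_eq0.
Qed.

Lemma iter_nonconstant f n : entire f -> nonconstant f -> nonconstant (iter n f).
Proof.
move=> ef ncf; elim: n => [|n IH]; first exact: nonconstant_id.
exact: (nonconstant_comp ef (@iter_entire f n ef) ncf IH).
Qed.

(* [z / (g z - g 0)] has a removable singularity at 0 and, as [g] is proper,
   is o(z) at infinity. *)
Lemma left_inverse_affine g h : entire g -> entire h -> cancel g h ->
  exists a b, forall z, g z = a * z + b.
Proof.
move=> eg eh gK.
have [d dP] := (derivable_cplxP g 0).1 (eg 0).
have [d' d'P] := (derivable_cplxP h (g 0)).1 (eh (g 0)).
pose G z := g z - g 0.
have G0 z : z != 0 -> G z != 0.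
  by apply: contra; rewrite subr_eq0 => /eqP/(can_inj gK)/eqP.
have dPG (e : R) : 0 < e -> exists2 r : R, 0 < r &
    forall z, cmod z < r -> cmod (G z - d * z) <= e * cmod z.
  by move=> /dP[r r0 rP]; exists r => // z /rP; rewrite add0r.
(* The chain rule for [h \o g = id] in terms of estimates: if [d = 0], a small [t > 0] would satisfy
   [t <= K * cmod (G t) <= K * m * t <= t / 2]. The bound [m <= 1] keeps [G t] within radius [r]. *)
have d0 : 0 < cmod d.
  rewrite cmod_gt0; apply/eqP => dE.
  have [r r0 rP] := d'P 1 ltr01.
  pose K := cmod d' + 1; have K0 : 0 < K by rewrite ltr_wpDl// cmod_ge0.
  pose m := Num.min 1 (2 * K)^-1.
  have m0 : 0 < m by rewrite lt_min ltr01 invr_gt0 mulr_gt0.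
  have [s s0 sP] := dPG _ m0.
  pose t := Num.min s r / 2.
  have sr0 : 0 < Num.min s r by rewrite lt_min s0.
  have t0 : 0 < t by rewrite divr_gt0.
  have tsr : t < Num.min s r by rewrite /t; lra.
  move: tsr; rewrite lt_min => /andP[ts tr].
  have tE : cmod (xy t 0) = t by rewrite -[RHS]gtr0_norm//; exact: cmod_real.
  have := sP (xy t 0); rewrite tE => /(_ ts); rewrite dE mul0r subr0 => Gt.
  have Gt1 : cmod (G (xy t 0)) <= t.
    by rewrite (le_trans Gt)// ler_piMl ?(ltW t0)// /m ge_min lexx.
  have := rP (G (xy t 0)) (le_lt_trans Gt1 tr).
  rewrite (addrC (g 0)) subrK !gK subr0 mul1r => ht.
  have : t <= K * (m * t).
    apply: le_trans (_ : K * cmod (G (xy t 0)) <= _); last by rewrite ler_pM2l.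
    have := ler_cmodD (xy t 0 - d' * G (xy t 0)) (d' * G (xy t 0)).
    rewrite subrK tE cmodM mulrDl mul1r; lra.
  have : K * m <= 2^-1.
    apply: le_trans (_ : K * (2 * K)^-1 <= _).
      by rewrite ler_pM2l// /m ge_min lexx orbT.
    by rewrite invfM mulrCA mulfV ?mulr1// gt_eqF.
  move=> Km; rewrite mulrA => tKm.
  have : K * m * t <= 2^-1 * t by rewrite ler_pM2r.
  lra.
(* The value at 0 is the limit of [z / G z] there. *)
pose F z := if z == 0 then d^-1 else z / G z.
have F0 : F 0 = d^-1 by rewrite /F eqxx.
have FE z : z != 0 -> F z = z / G z by move=> /negPf z0; rewrite /F z0.
have dF z : z != 0 -> derivable F z 1.
  move=> z0.
  have : derivable (fun z => z * (G z)^-1) z 1.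
    apply: (@derivableM _ _ (@id C)); first exact: derivable_id.
    apply: derivableV; first exact: G0.
    by apply: derivableB; [exact: eg|exact: derivable_cst].
  move=> /derivable_cplxP[l lP]; apply/derivable_cplxP; exists l => e /lP[r r0 rP].
  exists (Num.min r (cmod z)); first by rewrite lt_min r0 cmod_gt0.
  move=> w; rewrite lt_min => /andP[/rP wr wz].
  have zw0 : z + w != 0.
    apply: contraTneq wz => /eqP; rewrite addr_eq0 => /eqP ->.
    by rewrite cmodN ltxx.
  by rewrite !FE.
have cF : continuous F.
  move=> z; have [->|z0] := eqVneq z 0; last exact/derivable1_continuous/dF.
  apply/continuous_cplxP => e e0; rewrite F0.
  (* The first entry gives [cmod (G w) >= cmod d / 2 * cmod w]; with it the second bounds the
     difference of quotients by [e]. *)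
  pose m := Num.min (cmod d / 2) (e * cmod d * (cmod d / 2)).
  have d20 : 0 < cmod d / 2 by rewrite divr_gt0.
  have m0 : 0 < m by rewrite lt_min d20 !mulr_gt0.
  have [r r0 rP] := dPG _ m0; exists r => // w wr; rewrite add0r.
  have [->|w0] := eqVneq w 0; first by rewrite F0 subrr cmod0 ltW.
  have cw0 : 0 < cmod w by rewrite cmod_gt0.
  have Gw0 : 0 < cmod (G w) by rewrite cmod_gt0 G0.
  rewrite FE//; have -> : w / G w - d^-1 = - (G w - d * w) / (d * G w).
    by field; rewrite G0// -cmod_gt0.
  rewrite cmodM cmodN cmodV cmodM ler_pdivrMr ?mulr_gt0//.
  apply: le_trans (rP _ wr) _.
  have Gw : cmod d / 2 * cmod w <= cmod (G w).
    have := ler_cmodB (G w) (G w - d * w); rewrite opprB addrC subrK cmodM.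
    have := rP _ wr; have : m * cmod w <= cmod d / 2 * cmod w.
      by rewrite ler_pM2r// /m ge_min lexx.
    lra.
  apply: le_trans (_ : e * cmod d * (cmod d / 2) * cmod w <= _).
    by rewrite ler_pM2r// /m ge_min lexx orbT.
  by rewrite -[leLHS]mulrA [leRHS]mulrA ler_pM2l// mulr_gt0.
have subF (e : R) : 0 < e -> exists M : R, forall z, M <= cmod z ->
    cmod (F z) <= e * cmod z.
  move=> e0.
  (* Properness of [g]: where [cmod (g z) <= e^-1 + cmod (g 0)], the point [z = h (g z)] is bounded
     by [N]. Hence [cmod (G z) >= e^-1] for all larger [z]. *)
  have [N NP] := continuous_bounded (entire_continuous eh) (e^-1 + cmod (g 0)).
  exists (`|N| + 1) => z Nz.
  have z0 : z != 0.
    by rewrite -cmod_gt0 (lt_le_trans _ Nz)// ltr_wpDl.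
  have Gz : e^-1 <= cmod (G z).
    rewrite leNgt; apply/negP => Gz; have := NP (g z).
    have -> : g z = G z + g 0 by rewrite subrK.
    rewrite (le_trans (ler_cmodD _ _)) ?lerD2r ?(ltW Gz)// => /(_ isT).
    rewrite subrK gK => zN; have := ler_norm N; lra.
  have Gz0 : 0 < cmod (G z) by rewrite cmod_gt0 G0.
  rewrite FE// cmodM cmodV mulrC ler_wpM2r ?cmod_ge0//.
  by rewrite -[leRHS]invrK lef_pV2 ?posrE ?invr_gt0.
exists d, (g 0) => z; have [->|z0] := eqVneq z 0; first by rewrite mulr0 add0r.
have := @liouville_sublinear R F cF dF subF z; rewrite F0 FE// => zG.
have dn0 : d != 0 by rewrite -cmod_gt0.
have -> : g z = G z + g 0 by rewrite subrK.
congr (_ + _); have -> : z = (z / G z) * G z by rewrite divfK// G0.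
by rewrite zG mulrA mulfV// mul1r -zG divfK// G0.
Qed.

End EntireMaps.

(** * Semigroups of entire maps *)

Section RecurrentValues.

Lemma increasing_enumeration (P : nat -> Prop) :
  (forall n, exists2 m, (n <= m)%N & P m) ->
  exists2 phi : nat -> nat, {homo phi : m n / (m < n)%N} & forall n, P (phi n).
Proof.
move=> infP.
have /choice[next nextP] : forall n, exists m, (n <= m)%N /\ P m.
  by move=> n; have [m nm Pm] := infP n; exists m.
pose phi := fix phi n := if n is m.+1 then next (phi m).+1 else next 0%N.
exists phi; last by case=> [|n]; apply: (nextP _).2.
by apply: homo_ltn => [y x z|n]; [exact: ltn_trans|exact: (nextP _).1].
Qed.

(** Infinite pigeonhole principle: otherwise the indices with values in [A] would form a finite
    union of finite sets. *)
Lemma finite_set_recurrent (X : Type) (A : set X) (u : nat -> X) : finite_set A ->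
  (forall n, exists2 m, (n <= m)%N & A (u m)) ->
  exists a, forall n, exists2 m, (n <= m)%N & u m = a.
Proof.
move=> finA infA; apply: contrapT => nrec.
have : finite_set (\bigcup_(a in A) [set m | u m = a]).
  apply: bigcup_finite => // a _; apply: contrapT => infa; apply: nrec.
  exists a => n; apply: contrapT => nex; apply: infa.
  apply: (sub_finite_set (B := `I_n)) => // m /= um.
  by rewrite ltnNge; apply/negP => nm; apply: nex; exists m.
case/finite_seqP => s sE; have [m sm Am] := infA (\max_(i <- s) i).+1.
have : (\bigcup_(a in A) [set m | u m = a]) m by exists (u m).
rewrite sE /= => /leq_bigmax_seq - /(_ predT id isT).
by rewrite leqNgt sm.
Qed.

End RecurrentValues.

(** * Normality, escape and iteration in semigroups *)

Section Semigroups.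
Variable R : realType.
Local Notation C := (Cplx R).
Implicit Types (f g h : C -> C) (S T G : set (C -> C)) (D : set C) (z : C).

Lemma normal_on_subset T S D : T `<=` S -> normal_on S D -> normal_on T D.
Proof. by move=> TS nS u Tu; apply: nS => n; exact: TS. Qed.

Lemma normal_on_cofinite T S D : finite_set (S `\` T) ->
  normal_on T D -> normal_on S D.
Proof.
move=> finST nT u Su.
(* Either [u] visits [T] infinitely often and normality of [T] applies, or some element of the
   finite complement recurs and yields a constant, hence convergent, subsequence. *)
have [infT|ninfT] := pselect (forall n, exists2 m, (n <= m)%N & T (u m)).
  have [phi phi_incr Tphi] := increasing_enumeration infT.
  have [psi psi_incr cvgT] := nT (u \o phi) Tphi.
  by exists (phi \o psi) => // m n mn; exact/phi_incr/psi_incr.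
have [f fP] : exists f, forall n, exists2 m, (n <= m)%N & u m = f.
  apply: (finite_set_recurrent finST) => n; apply: contrapT => nex.
  apply: ninfT => k; exists (maxn n k); first exact: leq_maxr.
  apply: contrapT => nTu; apply: nex.
  by exists (maxn n k); [exact: leq_maxl|split].
have [phi phi_incr uphi] := increasing_enumeration fP.
exists phi => //; left; exists f.
by move=> A /nbhs_singleton Af; exists 0%N => // n _ /=; rewrite uphi.
Qed.

Lemma Fatou_cofinite T S : T `<=` S -> finite_set (S `\` T) -> Fatou S = Fatou T.
Proof.
move=> TS finST; apply/seteqP; split=> z [D [dD Dz nD]]; exists D; split=> //.
  exact: normal_on_subset nD.
exact: normal_on_cofinite nD.
Qed.

(** Neighbourhoods of [+oo] in [C] are given by real thresholds, so the condition can be expressed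
    over [R]. *)
Lemma cvg_norm_pinftyP (u : nat -> C) : `|u n| @[n --> \oo] --> +oo <->
  forall M : R, exists N, forall n, (N <= n)%N -> M < cmod (u n).
Proof.
split=> [u_oo M|uM A [M [/complex_realP[r ->] rA]]].
  have : (+oo : set_system C) [set w : C | (M%:C)%C < w].
    by exists (M%:C)%C; split=> //; apply/complex_realP; exists M.
  by move/u_oo => [N _ NP]; exists N => n /NP /=; rewrite normr_cmod ltcR.
have [N NP] := uM r; exists N => // n /NP rn; apply: rA.
by rewrite normr_cmod ltcR.
Qed.

Lemma iter_bounded f k (M : R) : continuous f -> exists N : R,
  forall i w, (i <= k)%N -> cmod w <= M -> cmod (iter i f w) <= N.
Proof.
move=> cf; elim: k => [|k [N NP]].
  by exists M => i w; rewrite leqn0 => /eqP->.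
have [N' N'P] := continuous_bounded cf N.
exists (Num.max N N') => i w; rewrite leq_eqVlt ltnS => /orP[/eqP->|ik] wM.
  by rewrite le_max N'P ?orbT// NP.
by rewrite le_max NP.
Qed.

(** If [f^n z] is in the disc of radius [M], at most [k] more steps lead to an iterate of [f^k],
    which is then bounded independently of [n]; for large [n] this contradicts escape under
    [f^k]. *)
Lemma iter_escape f k z : continuous f -> (0 < k)%N ->
  (forall M : R, exists N, forall n, (N <= n)%N -> M < cmod (iter n (iter k f) z)) ->
  forall M : R, exists N, forall n, (N <= n)%N -> M < cmod (iter n f z).
Proof.
move=> cf k0 esc M; have [M' M'P] := iter_bounded k M cf.
have [Q QP] := esc M'; exists (Q * k)%N => n Qkn.
rewrite ltNge; apply/negP => nM.
(* [q * k] is the first multiple of [k] beyond [n], and [q > Q] because [n >= Q * k]. *)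
pose q := (n %/ k).+1; have := QP q; rewrite -iterM.
have nq : (n <= q * k)%N by rewrite ltnW// ltn_ceil.
have qn : (q * k - n <= k)%N.
  by rewrite leq_subLR mulSn addnC leq_add2r leq_trunc_div.
rewrite -[in iter (q * k)](subnK nq) iterD ltNge M'P//.
by move=> /(_ _)/negP; apply=> //; rewrite ltnW// ltnS leq_divRL.
Qed.

Lemma generated_semigroup_cons G g h : G g -> generated_semigroup G h ->
  generated_semigroup G (g \o h).
Proof.
move=> Gg [m [k [Gk ->]]].
exists m.+1, (fun i => if unlift ord0 i is Some j then k j else g); split.
  by move=> i; case: unliftP.
rewrite [RHS]big_ord_recl unlift_none; congr (_ \o _).
by apply: eq_bigr => i _; rewrite liftK.
Qed.

(** Induction on word length, peeling off the outermost generator; it starts at single generators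
    since the empty composition is excluded. *)
Lemma generated_semigroup_ind G (P : (C -> C) -> Prop) :
  (forall g, G g -> P g) ->
  (forall g h, G g -> generated_semigroup G h -> P h -> P (g \o h)) ->
  forall f, generated_semigroup G f -> P f.
Proof.
move=> PG Pcons f [m [k [Gk ->]]]; elim: m k Gk => [|m IH] k Gk.
  by rewrite big_ord_recl big_ord0; exact: (PG _ (Gk ord0)).
rewrite big_ord_recl; apply: Pcons => //; last by apply: IH => i; exact: Gk.
by exists m, (fun i => k (lift ord0 i)); split=> // i; exact: Gk.
Qed.

Lemma generated_semigroup_comp G f h : generated_semigroup G f ->
  generated_semigroup G h -> generated_semigroup G (f \o h).
Proof.
move=> Gf Gh; elim/generated_semigroup_ind: f / Gf => [g Gg|g k Gg _ IH].
  exact: generated_semigroup_cons.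
exact: generated_semigroup_cons IH.
Qed.

Lemma iter_generated G f n : generated_semigroup G f ->
  generated_semigroup G (iter n.+1 f).
Proof.
by move=> Gf; elim: n => [|n IH] //; exact: (generated_semigroup_comp Gf IH).
Qed.

Lemma transcendental_nonconstant f : transcendental_entire f -> nonconstant f.
Proof.
move=> [_ ntf] c; apply: contrapT => nex; apply: ntf; exists c%:P => z.
by rewrite hornerC; apply/eqP; apply/negP => /negP fz; apply: nex; exists z.
Qed.

Lemma transcendental_not_left_invertible g h : transcendental_entire g ->
  entire h -> ~ cancel g h.
Proof.
move=> [eg ntg] eh gK; have [a [b gE]] := left_inverse_affine eg eh gK.
by apply: ntg; exists (a%:P * 'X + b%:P) => z; rewrite !hornerE gE.
Qed.

Lemma generated_entire G f : G `<=` @transcendental_entire R ->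
  generated_semigroup G f -> entire f /\ nonconstant f.
Proof.
move=> trG Gf; elim/generated_semigroup_ind: f / Gf => [g /trG tg|g k /trG tg _].
  by split; [exact: tg.1|exact: transcendental_nonconstant].
move=> [ek nck]; split; first exact: entire_comp tg.1 ek.
exact: nonconstant_comp tg.1 ek (transcendental_nonconstant tg) nck.
Qed.

(** The outer factor is only claimed to be entire, since it is the identity when [f] is a single
    generator. *)
Lemma generated_last_factor G f : G `<=` @transcendental_entire R ->
  generated_semigroup G f -> exists h g, [/\ entire h, G g & f = h \o g].
Proof.
move=> trG Gf; elim/generated_semigroup_ind: f / Gf => [g Gg|g k Gg _].
  by exists id, g; split=> //; exact: entire_id.
move=> [h [g' [eh Gg' ->]]]; exists (g \o h), g'.
by split; [exact: (entire_comp (trG _ Gg).1 eh)|exact: Gg'|].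
Qed.

(* As the image of an iterate is dense, [f ^ m = f ^ n] with [m < n] would give
   [f ^ (n - m) = id], so that the innermost factor of [f] would be invertible. *)
Lemma iter_generated_inj G f m n : G `<=` @transcendental_entire R ->
  generated_semigroup G f -> (m < n)%N -> iter m f <> iter n f.
Proof.
move=> trG Gf mn fmn; have [ef ncf] := generated_entire trG Gf.
have [h [g [eh Gg fE]]] := generated_last_factor trG Gf.
(* Since [n - m] is positive it can be written [p.+1], which leaves one factor [f = h \o g] to split
   off; [iter p f \o h] then inverts [g] on the left. *)
pose p := (n - m).-1.
have pE : p.+1 = (n - m)%N by rewrite prednK// subn_gt0.
have idE : iter p.+1 f = id.
  apply: (@eq_comp_nonconstant _ _ _ (iter m f)).
  - by apply: entire_continuous; exact: iter_entire.
  - by apply: entire_continuous; exact: entire_id.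
  - exact: iter_entire.
  - exact: iter_nonconstant.
  - apply/funext => z; rewrite pE /= -iterD subnK ?(ltnW mn)//.
    by rewrite -fmn.
apply: (@transcendental_not_left_invertible g (iter p f \o h)); first exact: trG.
  exact: (entire_comp (@iter_entire R f p ef) eh).
move=> z; rewrite /= -[in RHS](congr1 (@^~ z) idE) /= -iterS iterSr {3}fE.
by [].
Qed.

End Semigroups.

(** * Subsemigroups of finite Rees index *)

Theorem theorem3p1 (R : realType) (S T : set (Cplx R -> Cplx R))
    (hS : fg_transcendental_semigroup S) (hT : subsemigroup T S)
    (hTS : finite_rees_index T S) :
  escaping S = escaping T /\ Julia S = Julia T /\ Fatou S = Fatou T.
Proof.
have [n [k STk _]] := hTS; have [_ TS T_comp] := hT.
have finST : finite_set (S `\` T) by exists k.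
have FST := Fatou_cofinite TS finST.
split; last by rewrite /Julia FST.
have [G [_ trG SE]] := hS; apply/seteqP; split=> z escz f.
  by move=> Tf; apply: escz; exact: TS.
move=> Sf; have Gf : generated_semigroup G f by rewrite -SE.
(* Otherwise all positive iterates of [f] lie in the finite complement of [T], and one value is
   taken at two different orders. *)
have [m Tm] : exists m, T (iter m.+1 f).
  apply: contrapT => nT.
  have [|f' f'P] := @finite_set_recurrent _ _ (fun m => iter m.+1 f) finST.
    move=> m; exists m => //; split; last by move=> Tm; apply: nT; exists m.
    by rewrite SE; exact: iter_generated.
  (* Searching again from [i.+1] makes the second index strictly larger. *)
  have [i _ iE] := f'P 0%N; have [j ij jE] := f'P i.+1.
  by apply: (@iter_generated_inj R G f i.+1 j.+1) => //; rewrite jE.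
apply/cvg_norm_pinftyP.
apply: (@iter_escape R f m.+1) => //.
  by apply: entire_continuous; exact: (generated_entire trG Gf).1.
by apply/cvg_norm_pinftyP; exact: escz.
Qed.
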